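(* Let $n$ be a positive integer, $c,x_*\in\mathbb{R}^n$, $d\in\mathbb{R}$, $\delta\ge0$, let $M\in\mathbb{R}^{n\times n}$ be positive semidefinite, and let $f:\mathbb{R}^n\to\mathbb{R}$ be defined by $$f(x)=c^Tx+d-\sqrt{\delta^2+(x-x_* )^TM(x-x_* )}.$$ Then $f$ is bounded above if and only if $c\in\operatorname{col}(M)$ and $c^TM^+c\le1$.
   Context: A positive semidefinite matrix is a real symmetric matrix with non-negative eigenvalues. $\operatorname{col}(M)$ is the column space of $M$, and $M^+$ is the Moore–Penrose pseudoinverse of $M$. *)

(* Defs.v *)
From HB Require Import structures.
From mathcomp Require Import all_boot all_order all_algebra.
From mathcomp Require Import boolp classical_sets reals.

Set Implicit Arguments.
Unset Strict Implicit.
Unset Printing Implicit Defensive.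

Import Order.TTheory GRing.Theory Num.Theory.

Local Open Scope ring_scope.
Local Open Scope classical_set_scope.

(* [eigenvalue] refers to row eigenvectors, v *m M = a *: v; for symmetric M
   these are the transposes of the column eigenvectors. *)
Definition psdmx (R : realType) (n : nat) (M : 'M[R]_n) : Prop :=
  M^T = M /\ forall a : R, eigenvalue M a -> 0 <= a.

(* The four Penrose equations. *)
Definition penrose (R : realType) (m n : nat)
    (A : 'M[R]_(m, n)) (P : 'M[R]_(n, m)) : Prop :=
  [/\ A *m P *m A = A,
      P *m A *m P = P,
      (A *m P)^T = A *m P &
      (P *m A)^T = P *m A].

(* The default value 0 is never used: see [mp_pinvP] and [penrose_uniq].
   This is not MathComp's [pinvmx], which is only a one-sided partial inverse. *)
Definition mp_pinv (R : realType) (m n : nat) (A : 'M[R]_(m, n)) :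
    'M[R]_(n, m) :=
  xget 0 [set P | penrose A P].

Lemma penrose_uniq (R : realType) (m n : nat) (A : 'M[R]_(m, n))
    (P Q : 'M[R]_(n, m)) : penrose A P -> penrose A Q -> P = Q.
Proof.
move=> [P1 P2 P3 P4] [Q1 Q2 Q3 Q4].
have APQ : A *m P = A *m Q.
  rewrite -P3 -{1}Q1 -mulmxA trmx_mul P3 Q3 mulmxA.
  by rewrite P1.
have PAQ : P *m A = Q *m A.
  rewrite -P4 -{1}Q1 -mulmxA mulmxA trmx_mul P4 Q4 -mulmxA.
  by rewrite (mulmxA A P A) P1.
by rewrite -P2 -mulmxA APQ mulmxA PAQ Q2.
Qed.

Lemma gram_unitmx (R : realType) (m n : nat) (A : 'M[R]_(m, n)) :
  row_free A -> A *m A^T \in unitmx.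
Proof.
move=> freeA; rewrite -row_free_unit; apply: inj_row_free => v vAA.
apply: (row_free_inj freeA); rewrite mul0mx.
have /matrixP/(_ 0 0) : (v *m A) *m (v *m A)^T = 0.
  by rewrite trmx_mul -mulmxA (mulmxA A) mulmxA vAA mul0mx.
rewrite !mxE => /eqP; rewrite psumr_eq0 => [/allP z|j _]; last first.
  by rewrite [X in _ * X]mxE -expr2 sqr_ge0.
apply/rowP => j; have /z := mem_index_enum j.
by rewrite [X in _ * X]mxE -expr2 sqrf_eq0 [in RHS]mxE => /eqP.
Qed.

Lemma penrose_ex (R : realType) (m n : nat) (A : 'M[R]_(m, n)) :
  exists P, penrose A P.
Proof.
have [r [B [C [<- freeC fullB]]]] :
  exists r (B : 'M[R]_(m, r)) (C : 'M_(r, n)),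
    [/\ B *m C = A, row_free C & row_full B].
  exists (\rank A), (col_base A), (row_base A).
  by rewrite mulmx_base row_base_free col_base_full.
have uC : C *m C^T \in unitmx by apply: gram_unitmx.
have uB : B^T *m B \in unitmx.
  rewrite -{2}[B]trmxK; apply: gram_unitmx.
  by rewrite /row_free mxrank_tr.
have symB : (invmx (B^T *m B))^T = invmx (B^T *m B).
  by rewrite trmx_inv trmx_mul trmxK.
have symC : (invmx (C *m C^T))^T = invmx (C *m C^T).
  by rewrite trmx_inv trmx_mul trmxK.
pose P := C^T *m invmx (C *m C^T) *m (invmx (B^T *m B) *m B^T).
have AP : (B *m C) *m P = B *m invmx (B^T *m B) *m B^T.
  by rewrite /P !mulmxA -(mulmxA B C) -(mulmxA B (C *m _)) mulmxV // mulmx1.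
have PA : P *m (B *m C) = C^T *m invmx (C *m C^T) *m C.
  rewrite /P -!mulmxA (mulmxA B^T) (mulmxA (invmx (B^T *m B))) mulVmx //.
  by rewrite mul1mx.
exists P; split.
- by rewrite AP mulmxA -(mulmxA _ B^T) mulmxKV.
- by rewrite PA /P !mulmxA -(mulmxA _ C C^T) mulmxKV.
- by rewrite AP !trmx_mul trmxK symB mulmxA.
- by rewrite PA !trmx_mul trmxK symC mulmxA.
Qed.

Lemma mp_pinvP (R : realType) (m n : nat) (A : 'M[R]_(m, n)) :
  penrose A (mp_pinv A).
Proof. by have [P PA] := penrose_ex A; exact: (xgetI 0 PA). Qed.

(* Main.v *)
Require Import Defs.
From HB Require Import structures.
From mathcomp Require Import all_boot all_order all_algebra.
From mathcomp Require Import boolp classical_sets reals.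
From mathcomp Require Import complex ring lra.

(** Write x = xs + y.  Up to a constant, f is the linear form c^T y minus
    sqrt (delta^2 + y^T M y), and this square root lies between sqrt (y^T M y)
    and delta + sqrt (y^T M y).  So boundedness of f compares a linear form with
    the seminorm |y|_M = sqrt (y^T M y).

    If f is bounded above, then its growth along every ray is nonpositive, that
    is, c^T v <= |v|_M for all v ([affine_bounded_le0]).  Taking v and - v in
    the kernel of M gives that c is orthogonal to ker M, hence lies in the column
    space: c = M w.  Then q := c^T M^+ c = w^T M w by the first Penrose equation
    ([pinv_form]), and the choice v = w gives q <= sqrt q, so q <= 1.

    Conversely, if c = M w and q <= 1, then c^T y = w^T M y is at most
    |w|_M |y|_M <= |y|_M by the Cauchy-Schwarz inequality for M
    ([psdmx_form_le]), so f is bounded by its constant term.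

    Both directions use that the quadratic form of M is nonnegative, which
    [psdmx_form_ge0] derives from the sign of the real eigenvalues by
    diagonalizing M over R[i]. *)

Import Order.TTheory GRing.Theory Num.Theory.

Local Open Scope ring_scope.
Local Open Scope classical_set_scope.

(** Over R[i] the real symmetric M becomes Hermitian, so M = P^* D P with P
    unitary and D real.  The entries of D are eigenvalues of M over R, as
    eigenvalues in the base field are insensitive to field extension, hence
    nonnegative; and u^T M u is the sum of the D_j |w_j|^2 for w = P u. *)
Lemma psdmx_form_ge0 {R : realType} {n : nat} {M : 'M[R]_n} (u : 'cV[R]_n) :
  psdmx M -> 0 <= (u^T *m M *m u) 0 0.
Proof.
move=> [Msym Meig].
pose toC : {rmorphism R -> R[i]} := real_complex R.
pose A := map_mx toC M.
have toC_real x : toC x \is Num.real by apply/complex_realP; exists x.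
have A_sym : A^T = A by rewrite /A map_trmx Msym.
have A_herm : A \is hermsymmx.
  apply: realsym_hermsym.
    by apply/is_hermitianmxP; rewrite expr0 scale1r map_mx_id.
  by apply/mxOverP => i j; rewrite mxE.
have A_spec : A = _ := orthomx_spectralP (hermitian_normalmx A_herm).
set P := spectralmx A in A_spec; set D := spectral_diag A in A_spec.
have P_unit : P \in unitmx := spectral_unit A.
have D_ge0 j : 0 <= D 0 j.
  have /complex_realP [a Da] : D 0 j \is Num.real.
    exact: mxOverP (hermitian_spectral_diag_real A_herm) 0 j.
  suff : eigenvalue M a by move=> /Meig; rewrite Da ler0c.
  rewrite -(eigenvalue_map toC) -/A -[toC a]/(real_complex R a) -Da.
  (* P A = D P, so each row of P is a row eigenvector of A. *)
  apply/eigenvalueP; exists (row j P).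
    rewrite -row_mul {1}A_spec !mulmxA mulmxV // mul1mx.
    by rewrite row_mul row_diag_mx -scalemxAl -rowE.
  rewrite rowE mulmx_free_eq0 ?row_free_unit //.
  apply/eqP => /matrixP /(_ 0 j); rewrite !mxE !eqxx => /eqP.
  by rewrite oner_eq0.
(* The row w is u^T P^*, the conjugate transpose of the vector P u. *)
pose w := map_mx toC u^T *m (P ^t Num.conj)%sesqui.
have form_w :
    toC ((u^T *m M *m u) 0 0) =
    (w *m diag_mx D *m (w ^t Num.conj)%sesqui) 0 0.
  have uC : ((map_mx toC u^T) ^t Num.conj)%sesqui = map_mx toC u.
    by apply/matrixP => i j; rewrite !mxE; apply/CrealP.
  rewrite /w trmx_mul map_mxM trmxCK uC.
  have -> : map_mx toC u^T *m (P ^t Num.conj)%sesqui *m diag_mx D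
     *m (P *m map_mx toC u) = map_mx toC u^T *m A *m map_mx toC u.
    by rewrite {1}A_spec invmx_unitary ?spectral_unitarymx // !mulmxA.
  by rewrite /A -!map_mxM [RHS]mxE.
rewrite -ler0c -[X in _ <= X]/(toC _) form_w mxE sumr_ge0 // => j _.
by rewrite mul_mx_diag !mxE mulrAC mulr_ge0 // mul_conjC_ge0.
Qed.

Lemma symmx_form_comb {R : comRingType} {n : nat} {M : 'M[R]_n} (x y : 'cV[R]_n)
    (t : R) : M^T = M ->
  ((x + t *: y)^T *m M *m (x + t *: y)) 0 0 =
  (x^T *m M *m x) 0 0 + 2 * t * (y^T *m M *m x) 0 0
  + t ^+ 2 * (y^T *m M *m y) 0 0.
Proof.
move=> Msym.
have xy : x^T *m M *m y = (y^T *m M *m x)^T.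
  by rewrite !trmx_mul trmxK Msym mulmxA.
rewrite [(_ + _)^T]linearD /= [(_ *: _)^T]linearZ /= !mulmxDl !mulmxDr.
rewrite -!scalemxAl -!scalemxAr xy !mxE.
ring.
Qed.

(** The Cauchy-Schwarz inequality for the semi-inner product given by M, in the
    case where w has seminorm at most 1; the term delta^2 only enlarges the
    right-hand side. *)
Lemma psdmx_form_le {R : realType} {n : nat} {M : 'M[R]_n} (w y : 'cV[R]_n)
    (delta : R) : psdmx M -> (w^T *m M *m w) 0 0 <= 1 ->
  (w^T *m M *m y) 0 0 <= Num.sqrt (delta ^+ 2 + (y^T *m M *m y) 0 0).
Proof.
move=> Mpsd; have [Msym _] := Mpsd.
set q := (w^T *m M *m w) 0 0; set b := (w^T *m M *m y) 0 0 => q_le1.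
(* The form at y - b w is y^T M y - 2 b^2 + b^2 q, and q <= 1 bounds it by
   y^T M y - b^2.  The projection coefficient b / q is replaced by b, which also
   covers q = 0. *)
have := psdmx_form_ge0 (y + (- b) *: w) Mpsd.
rewrite (symmx_form_comb _ _ _ Msym) -/b -/q => ge0.
apply: le_trans (ler_norm b) _; rewrite -sqrtr_sqr ler_wsqrtr //.
have := sqr_ge0 delta; have : 0 <= b ^+ 2 * (1 - q).
  by rewrite mulr_ge0 ?sqr_ge0 ?subr_ge0.
nra.
Qed.

Lemma affine_bounded_le0 {R : realFieldType} (k a B : R) :
  (forall t, 0 <= t -> k + t * a <= B) -> a <= 0.
Proof.
move=> le_B; rewrite leNgt; apply/negP => a_gt0.
(* At this t the affine function takes the value k + |B - k| + 1 > B. *)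
have t_ge0 : 0 <= (`|B - k| + 1) / a.
  by rewrite divr_ge0 ?addr_ge0 // ltW.
have := le_B _ t_ge0; rewrite divfK ?gt_eqF //.
by have := ler_norm (B - k); lra.
Qed.

(** For c = M w this evaluates c^T M^+ c: the symmetry of M turns it into
    w^T (M M^+ M) w. *)
Lemma pinv_form {R : realType} {n : nat} {M : 'M[R]_n} (w : 'cV[R]_n) :
  M^T = M -> (M *m w)^T *m mp_pinv M *m (M *m w) = w^T *m M *m w.
Proof.
move=> Msym; have [MPM _ _ _] := mp_pinvP M.
by rewrite trmx_mul Msym -[in RHS]MPM !mulmxA.
Qed.

Theorem theorem16 (R : realType) (n : nat) (n_gt0 : (0 < n)%N)
    (c xs : 'cV[R]_n) (d delta : R) (delta_ge0 : 0 <= delta)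
    (M : 'M[R]_n) (M_psd : psdmx M)
    (f : 'cV[R]_n -> R)
    (fE : forall x : 'cV[R]_n,
       f x = (c^T *m x) 0 0 + d
             - Num.sqrt (delta ^+ 2 + ((x - xs)^T *m M *m (x - xs)) 0 0)) :
  has_ubound (range f) <->
  (c^T <= M^T)%MS /\ (c^T *m mp_pinv M *m c) 0 0 <= 1.
Proof.
have [Msym _] := M_psd; pose k := (c^T *m xs) 0 0 + d.
have f_shift y : f (xs + y) = k + (c^T *m y) 0 0
    - Num.sqrt (delta ^+ 2 + (y^T *m M *m y) 0 0).
  by rewrite fE (addrC xs) addrK mulmxDr mxE /k; ring.
split=> [[B f_le]|[c_col q_le1]].
  have ent_scale (s : R) (A : 'M[R]_1) : (s *: A) 0 0 = s * A 0 0.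
    by rewrite mxE.
  (* sqrt (delta^2 + t^2 a) <= delta + t sqrt a bounds f from below on a ray. *)
  have ray (v : 'cV[R]_n) (t : R) : 0 <= t ->
      k - delta + t * ((c^T *m v) 0 0 - Num.sqrt ((v^T *m M *m v) 0 0)) <= B.
    move=> t_ge0; have v_ge0 := psdmx_form_ge0 v M_psd.
    have {f_le} := f_le _ (ex_intro2 _ _ (xs + t *: v) I erefl).
    apply: le_trans; rewrite f_shift [(t *: v)^T]linearZ /=.
    rewrite -!scalemxAl -!scalemxAr !ent_scale.
    set a := (v^T *m M *m v) 0 0 in v_ge0 *.
    have s_ge0 := sqrtr_ge0 a; have s_sqr := sqr_sqrtr v_ge0.
    suff : Num.sqrt (delta ^+ 2 + t * (t * a)) <= delta + t * Num.sqrt a by lra.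
    rewrite -[leRHS]ger0_norm ?addr_ge0 ?mulr_ge0 // -sqrtr_sqr ler_wsqrtr //.
    rewrite sqrrD exprMn s_sqr.
    have : 0 <= delta * (t * Num.sqrt a) by rewrite !mulr_ge0.
    lra.
  have slope (v : 'cV[R]_n) := affine_bounded_le0 _ _ _ (ray v).
  have c_col : (c^T <= M^T)%MS.
    (* The columns of the cokernel of M span ker M; c kills each of them. *)
    rewrite submxE Msym; apply/eqP/matrixP => i j; rewrite ord1 [RHS]mxE.
    have slope0 (v : 'cV[R]_n) : M *m v = 0 -> (c^T *m v) 0 0 <= 0.
      by move=> Mv; have := slope v;
        rewrite -mulmxA Mv mulmx0 [X in Num.sqrt X]mxE sqrtr0 subr0.
    have Mv : M *m (cokermx M *m delta_mx j 0) = 0 :> 'cV[R]_n.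
      by rewrite mulmxA mulmx_coker mul0mx.
    have := slope0 _ Mv; have := slope0 (- (cokermx M *m delta_mx j 0)).
    rewrite !mulmxN Mv oppr0 => /(_ erefl).
    rewrite mulmxA -colE; move: (_ *m _) => A; rewrite !mxE; lra.
  split=> //; move/submxP: c_col => [w /(congr1 trmx)].
  rewrite trmx_mul !trmxK => cE.
  (* Since c^T w = q, the slope along w is q - sqrt q. *)
  have := slope w^T; rewrite cE pinv_form // trmx_mul Msym.
  set q := (_ *m M *m _) 0 0 => slope_w.
  have q_ge0 : 0 <= q := psdmx_form_ge0 _ M_psd.
  have := sqr_sqrtr q_ge0; have := sqrtr_ge0 q; nra.
exists k => _ [x _ <-].
have -> : x = xs + (x - xs) by rewrite addrC subrK.
rewrite f_shift; move/submxP: c_col q_le1 => [w /(congr1 trmx)].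
rewrite trmx_mul !trmxK => ->; rewrite pinv_form // => q_le1.
have := psdmx_form_le w^T (x - xs) delta M_psd q_le1.
by rewrite trmx_mul Msym; lra.
Qed.
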